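(* The category $\omega\mathbf{EA}$ of $\omega$-complete effect algebras and $\omega$-normal effect algebra homomorphisms is equivalent to the Eilenberg-Moore category of the $\omega$-Kalmbach monad over the category $\mathbf{BPos}$ of bounded posets.
   Context: **Bounded posets.** A poset is bounded when it has a minimum $0$ and a maximum $1$. $\mathbf{BPos}$ is the category of bounded posets and order-preserving maps preserving $0$ and $1$. A bounded poset is $\omega$-complete when every increasing sequence $a_1\leq a_2\leq\cdots$ has a supremum. A monotone map $f$ between $\omega$-complete bounded posets is $\omega$-normal when $f(\bigvee_i x_i)=\bigvee_i f(x_i)$ for every increasing sequence $x_1\leq x_2\leq\cdots$. **Effect algebras.** An effect algebra is a set $E$ with an element $0$, a partial binary operation $\oplus$ and a total unary operation $(\ )^\perp$ such that, writing $a\perp b$ when $a\oplus b$ is defined and $1:=0^\perp$: (i) if $a\perp b$ then $b\perp a$ and $a\oplus b=b\oplus a$; (ii) $a\perp 0$ and $a\oplus 0=a$; (iii) if $a\perp b$ and $(a\oplus b)\perp c$ then $b\perp c$, $a\perp(b\oplus c)$ and $(a\oplus b)\oplus c=a\oplus(b\oplus c)$; (iv) $a^\perp$ is the unique element with $a\oplus a^\perp=1$; (v) if $a\perp 1$ then $a=0$. It is a bounded poset under $a\leq b$ iff $a\oplus c=b$ for some $c$. A homomorphism is a map $f$ with $f(1)=1$ such that $a\perp b$ implies $f(a)\perp f(b)$ and $f(a\oplus b)=f(a)\oplus f(b)$. **The category and the monad.** $\omega\mathbf{EA}$ has as objects the effect algebras whose underlying bounded poset is $\omega$-complete, and as morphisms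 the effect algebra homomorphisms that are $\omega$-normal. The forgetful functor $U:\omega\mathbf{EA}\to\mathbf{BPos}$ has a left adjoint $K_\omega$ (the $\omega$-Kalmbach extension). The $\omega$-Kalmbach monad is the monad $U\circ K_\omega$ on $\mathbf{BPos}$ induced by the adjunction $K_\omega\dashv U$. *)

(* Defs.v *)
From HB Require Import structures.
From mathcomp Require Import all_boot all_order.
From mathcomp Require Import boolp classical_sets.

Set Implicit Arguments.
Unset Strict Implicit.
Unset Printing Implicit Defensive.

Declare Scope cat_scope.
Delimit Scope cat_scope with cat.
Local Open Scope classical_set_scope.
Local Open Scope cat_scope.

Record category := Category {
  obj :> Type;
  hom : obj -> obj -> Type;
  idm : forall a, hom a a;
  ccomp : forall a b c, hom b c -> hom a b -> hom a c;
  ccomp_idl : forall a b (f : hom a b), ccomp (idm b) f = f;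
  ccomp_idr : forall a b (f : hom a b), ccomp f (idm a) = f;
  ccompA : forall a b c d (h : hom c d) (g : hom b c) (f : hom a b),
    ccomp h (ccomp g f) = ccomp (ccomp h g) f
}.
Arguments hom {c} _ _ : rename.
Arguments idm {c} _ : rename.
Arguments ccomp {c a b c0} _ _ : rename.

Notation "g \oc f" := (ccomp g f) (at level 40, left associativity) : cat_scope.

Record functor (C D : category) := Functor {
  fobj :> C -> D;
  fmap : forall a b : C, hom a b -> hom (fobj a) (fobj b);
  fmap_id : forall a : C, fmap (idm a) = idm (fobj a);
  fmap_comp : forall (a b c : C) (g : hom b c) (f : hom a b),
    fmap (g \oc f) = fmap g \oc fmap f
}.
Arguments fmap {C D} _ {a b} _.

Definition functor_id (C : category) : functor C C :=
  @Functor C C (fun a => a) (fun a b f => f) (fun a => erefl)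
    (fun a b c g f => erefl).

Lemma functor_comp_id (C D E : category) (G : functor D E) (F : functor C D)
    (a : C) : fmap G (fmap F (idm a)) = idm (G (F a)).
Proof. by rewrite !fmap_id. Qed.

Lemma functor_comp_comp (C D E : category) (G : functor D E) (F : functor C D)
    (a b c : C) (g : hom b c) (f : hom a b) :
  fmap G (fmap F (g \oc f)) = fmap G (fmap F g) \oc fmap G (fmap F f).
Proof. by rewrite !fmap_comp. Qed.

Definition functor_comp (C D E : category) (G : functor D E) (F : functor C D)
    : functor C E :=
  @Functor C E (fun a => G (F a)) (fun a b f => fmap G (fmap F f))
    (functor_comp_id G F) (functor_comp_comp G F).

Record nat_trans (C D : category) (F G : functor C D) := NatTrans {
  component :> forall a : C, hom (F a) (G a);
  naturality : forall (a b : C) (f : hom a b),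
    component b \oc fmap F f = fmap G f \oc component a
}.

Definition is_iso (C : category) (a b : C) (f : hom a b) : Prop :=
  exists g : hom b a, g \oc f = idm a /\ f \oc g = idm b.

Definition naturally_isomorphic (C D : category) (F G : functor C D) : Prop :=
  exists alpha : nat_trans F G, forall a, is_iso (alpha a).

Definition equivalent_categories (C D : category) : Prop :=
  exists (F : functor C D) (G : functor D C),
    naturally_isomorphic (functor_comp G F) (functor_id C) /\
    naturally_isomorphic (functor_comp F G) (functor_id D).

(* [adjunction F G]: [F] is left adjoint to [G]. *)
Record adjunction (C D : category) (F : functor C D) (G : functor D C) :=
  Adjunction {
  adj_unit : nat_trans (functor_id C) (functor_comp G F);
  adj_counit : nat_trans (functor_comp F G) (functor_id D);
  adj_triangle_left : forall a : C,
    adj_counit (F a) \oc fmap F (adj_unit a) = idm (F a);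
  adj_triangle_right : forall b : D,
    fmap G (adj_counit b) \oc adj_unit (G b) = idm (G b)
}.

Record monad (C : category) := Monad {
  monad_functor :> functor C C;
  monad_unit : nat_trans (functor_id C) monad_functor;
  monad_mult : nat_trans (functor_comp monad_functor monad_functor)
                         monad_functor;
  monad_unitl : forall a : C,
    monad_mult a \oc monad_unit (monad_functor a) = idm (monad_functor a);
  monad_unitr : forall a : C,
    monad_mult a \oc fmap monad_functor (monad_unit a)
    = idm (monad_functor a);
  monad_multA : forall a : C,
    monad_mult a \oc fmap monad_functor (monad_mult a)
    = monad_mult a \oc monad_mult (monad_functor a)
}.

Section AdjunctionMonad.
Context (C D : category) (F : functor C D) (G : functor D C).
Context (adj : adjunction F G).

Let T := functor_comp G F.

Lemma adj_mult_natural (a b : C) (f : hom a b) :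
  fmap G (adj_counit adj (F b)) \oc fmap (functor_comp T T) f
  = fmap T f \oc fmap G (adj_counit adj (F a)).
Proof.
by rewrite /= -!fmap_comp; congr fmap; exact: (naturality (adj_counit adj)).
Qed.

Definition adj_mult : nat_trans (functor_comp T T) T :=
  @NatTrans C C (functor_comp T T) T
    (fun a => fmap G (adj_counit adj (F a))) adj_mult_natural.

Lemma adj_monad_unitl (a : C) :
  adj_mult a \oc adj_unit adj (T a) = idm (T a).
Proof. exact: (adj_triangle_right adj (F a)). Qed.

Lemma adj_monad_unitr (a : C) :
  adj_mult a \oc fmap T (adj_unit adj a) = idm (T a).
Proof. by rewrite /= -fmap_comp adj_triangle_left fmap_id. Qed.

Lemma adj_monad_multA (a : C) :
  adj_mult a \oc fmap T (adj_mult a) = adj_mult a \oc adj_mult (T a).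
Proof.
by rewrite /= -!fmap_comp; congr fmap; exact: (naturality (adj_counit adj)).
Qed.

Definition adjunction_monad : monad C :=
  @Monad C T (adj_unit adj) adj_mult
    adj_monad_unitl adj_monad_unitr adj_monad_multA.

End AdjunctionMonad.

Record em_algebra (C : category) (T : monad C) := EMAlgebra {
  em_carrier :> C;
  em_action : hom (T em_carrier) em_carrier;
  em_action_unit : em_action \oc monad_unit T em_carrier = idm em_carrier;
  em_action_mult :
    em_action \oc fmap T em_action = em_action \oc monad_mult T em_carrier
}.

Record em_hom (C : category) (T : monad C) (X Y : em_algebra T) := EMHom {
  em_map :> hom (em_carrier X) (em_carrier Y);
  em_map_action : em_map \oc em_action X = em_action Y \oc fmap T em_map
}.

Lemma em_hom_eq (C : category) (T : monad C) (X Y : em_algebra T)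
    (f g : em_hom X Y) : em_map f = em_map g -> f = g.
Proof.
case: f g => [f fP] [g gP] /= fg; rewrite fg in fP *.
by congr EMHom; exact: Prop_irrelevance.
Qed.

Section EilenbergMoore.
Context (C : category) (T : monad C).

Lemma em_id_subproof (X : em_algebra T) :
  idm (em_carrier X) \oc em_action X = em_action X \oc fmap T (idm _).
Proof. by rewrite fmap_id ccomp_idl ccomp_idr. Qed.

Definition em_id (X : em_algebra T) : em_hom X X := EMHom (em_id_subproof X).

Lemma em_comp_subproof (X Y Z : em_algebra T) (g : em_hom Y Z)
    (f : em_hom X Y) :
  (em_map g \oc em_map f) \oc em_action X
  = em_action Z \oc fmap T (em_map g \oc em_map f).
Proof.
by rewrite -ccompA em_map_action ccompA em_map_action -ccompA fmap_comp.
Qed.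

Definition em_comp (X Y Z : em_algebra T) (g : em_hom Y Z) (f : em_hom X Y) :
  em_hom X Z := EMHom (em_comp_subproof g f).

Lemma em_comp_idl X Y (f : em_hom X Y) : em_comp (em_id Y) f = f.
Proof. by apply: em_hom_eq; exact: ccomp_idl. Qed.

Lemma em_comp_idr X Y (f : em_hom X Y) : em_comp f (em_id X) = f.
Proof. by apply: em_hom_eq; exact: ccomp_idr. Qed.

Lemma em_compA X Y Z W (h : em_hom Z W) (g : em_hom Y Z) (f : em_hom X Y) :
  em_comp h (em_comp g f) = em_comp (em_comp h g) f.
Proof. by apply: em_hom_eq; exact: ccompA. Qed.

Definition eilenberg_moore : category :=
  Category em_comp_idl em_comp_idr em_compA.

End EilenbergMoore.

(* MathComp orders are indexed by a display, a tag that only steers notations;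
   fixing one loses no bounded poset. *)
Fact bpos_display : Order.disp_t. Proof. exact: Order.Disp tt tt. Qed.

Notation bposType := (tbPOrderType bpos_display).

Record bpos_hom (A B : bposType) := BPosHom {
  bpos_fun :> A -> B;
  bpos_homo : {homo bpos_fun : x y / (x <= y)%O};
  bpos_bot : bpos_fun \bot%O = \bot%O;
  bpos_top : bpos_fun \top%O = \top%O
}.

Lemma bpos_hom_eq (A B : bposType) (f g : bpos_hom A B) : f =1 g -> f = g.
Proof.
case: f g => [f f1 f2 f3] [g g1 g2 g3] /= /funext fg.
case: _ / fg g1 g2 g3 => g1 g2 g3.
by congr BPosHom; exact: Prop_irrelevance.
Qed.

Definition bpos_id (A : bposType) : bpos_hom A A :=
  @BPosHom A A (fun x => x) (fun x y h => h) erefl erefl.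

Lemma bpos_comp_bot (A B C : bposType) (g : bpos_hom B C) (f : bpos_hom A B) :
  g (f \bot%O) = \bot%O.
Proof. by rewrite !bpos_bot. Qed.

Lemma bpos_comp_top (A B C : bposType) (g : bpos_hom B C) (f : bpos_hom A B) :
  g (f \top%O) = \top%O.
Proof. by rewrite !bpos_top. Qed.

Definition bpos_comp (A B C : bposType) (g : bpos_hom B C)
    (f : bpos_hom A B) : bpos_hom A C :=
  @BPosHom A C (fun x => g (f x))
    (fun x y h => bpos_homo g (bpos_homo f h))
    (bpos_comp_bot g f) (bpos_comp_top g f).

Lemma bpos_comp_idl A B (f : bpos_hom A B) : bpos_comp (bpos_id B) f = f.
Proof. exact: bpos_hom_eq. Qed.

Lemma bpos_comp_idr A B (f : bpos_hom A B) : bpos_comp f (bpos_id A) = f.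
Proof. exact: bpos_hom_eq. Qed.

Lemma bpos_compA A B C D (h : bpos_hom C D) (g : bpos_hom B C)
    (f : bpos_hom A B) :
  bpos_comp h (bpos_comp g f) = bpos_comp (bpos_comp h g) f.
Proof. exact: bpos_hom_eq. Qed.

Definition BPos : category := Category bpos_comp_idl bpos_comp_idr bpos_compA.

Definition increasing_seq (A : bposType) (x : nat -> A) : Prop :=
  {homo x : m n / (m <= n)%N >-> (m <= n)%O}.

Definition omega_complete (A : bposType) : Prop :=
  forall x : nat -> A, increasing_seq x -> exists s, supremums (range x) s.

(* Suprema are unique, so between omega-complete bounded posets this says that
   [f] sends the supremum of [x] to the supremum of [f \o x]. *)
Definition omega_normal (A B : bposType) (f : A -> B) : Prop :=
  forall (x : nat -> A) (s : A), increasing_seq x ->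
    supremums (range x) s -> supremums (range (f \o x)) (f s).

(* [oplus a b = None] means that the sum of [a] and [b] is undefined. *)
Record effectAlgebra := EffectAlgebra {
  ea_sort :> Type;
  ea0 : ea_sort;
  oplus : ea_sort -> ea_sort -> option ea_sort;
  orth : ea_sort -> ea_sort;
  oplusC : forall a b, oplus a b = oplus b a;
  oplus0 : forall a, oplus a ea0 = Some a;
  oplusA : forall a b c ab abc,
    oplus a b = Some ab -> oplus ab c = Some abc ->
    exists2 bc, oplus b c = Some bc & oplus a bc = Some abc;
  orthP : forall a b, oplus a b = Some (orth ea0) <-> b = orth a;
  oplus1_eq0 : forall a, isSome (oplus a (orth ea0)) -> a = ea0
}.
Arguments ea0 {e} : rename.
Arguments oplus {e} _ _ : rename.
Arguments orth {e} _ : rename.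

Definition ea1 (E : effectAlgebra) : E := orth ea0.
Arguments ea1 {E}.

HB.instance Definition _ (E : effectAlgebra) := gen_eqMixin (ea_sort E).
HB.instance Definition _ (E : effectAlgebra) := gen_choiceMixin (ea_sort E).

Definition ea_le (E : effectAlgebra) (a b : E) : bool :=
  `[< exists c, oplus a c = Some b >].

Lemma ea_le_refl (E : effectAlgebra) : reflexive (@ea_le E).
Proof. by move=> a; apply/asboolP; exists ea0; exact: oplus0. Qed.

Lemma ea_le_anti (E : effectAlgebra) : antisymmetric (@ea_le E).
Proof.
move=> a b /andP[/asboolP[c ac] /asboolP[d bd]].
have [cd cdE acd] := oplusA ac bd.
have aa' : oplus a (orth a) = Some (orth ea0) by apply/orthP.
rewrite oplusC in acd; have [z zE cdz] := oplusA acd aa'.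
have cd0 : cd = ea0.
  by apply: oplus1_eq0; move: zE; rewrite aa' => -[->]; rewrite cdz.
have c01 : oplus cd (orth ea0) = Some (orth ea0).
  by rewrite cd0 oplusC oplus0.
have [y dy _] := oplusA cdE c01.
have d0 : d = ea0 by apply: oplus1_eq0; rewrite dy.
by move: bd; rewrite d0 oplus0 => -[].
Qed.

Lemma ea_le_trans (E : effectAlgebra) : transitive (@ea_le E).
Proof.
move=> b a e /asboolP[c ac] /asboolP[d bd]; apply/asboolP.
by have [cd _ acd] := oplusA ac bd; exists cd.
Qed.

Lemma ea_le0 (E : effectAlgebra) (a : E) : ea_le ea0 a.
Proof. by apply/asboolP; exists a; rewrite oplusC oplus0. Qed.

Lemma ea_le1 (E : effectAlgebra) (a : E) : ea_le a ea1.
Proof. by apply/asboolP; exists (orth a); apply/orthP. Qed.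

HB.instance Definition _ (E : effectAlgebra) :=
  Order.Le_isPOrder.Build bpos_display (ea_sort E)
    (@ea_le_refl E) (@ea_le_anti E) (@ea_le_trans E).
HB.instance Definition _ (E : effectAlgebra) :=
  Order.hasBottom.Build bpos_display (ea_sort E) (@ea_le0 E).
HB.instance Definition _ (E : effectAlgebra) :=
  Order.hasTop.Build bpos_display (ea_sort E) (@ea_le1 E).

Definition ea_bpos (E : effectAlgebra) : bposType := ea_sort E.

Lemma ea_leP (E : effectAlgebra) (a b : E) :
  (a <= b)%O <-> exists c, oplus a c = Some b.
Proof. by split => /asboolP. Qed.

Record omegaEA_obj := OmegaEAObj {
  oea_ea :> effectAlgebra;
  oea_complete : omega_complete (ea_bpos oea_ea)
}.

Record omegaEA_hom (E F : omegaEA_obj) := OmegaEAHom {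
  oea_fun :> E -> F;
  oea_one : oea_fun ea1 = ea1;
  oea_oplus : forall a b c,
    oplus a b = Some c -> oplus (oea_fun a) (oea_fun b) = Some (oea_fun c);
  oea_normal : @omega_normal (ea_bpos E) (ea_bpos F) oea_fun
}.

Lemma omegaEA_hom_eq (E F : omegaEA_obj) (f g : omegaEA_hom E F) :
  f =1 g -> f = g.
Proof.
case: f g => [f f1 f2 f3] [g g1 g2 g3] /= /funext fg.
case: _ / fg g1 g2 g3 => g1 g2 g3.
by congr OmegaEAHom; exact: Prop_irrelevance.
Qed.

Lemma omegaEA_hom_homo (E F : omegaEA_obj) (f : omegaEA_hom E F) :
  {homo (f : ea_bpos E -> ea_bpos F) : x y / (x <= y)%O}.
Proof.
by move=> x y /ea_leP[c xc]; apply/ea_leP; exists (f c); exact: oea_oplus.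
Qed.

Lemma omegaEA_hom0 (E F : omegaEA_obj) (f : omegaEA_hom E F) :
  f ea0 = ea0.
Proof.
apply: oplus1_eq0; have /(oea_oplus f) : oplus ea0 ea1 = Some (@ea1 E).
  by rewrite oplusC oplus0.
by rewrite !oea_one => ->.
Qed.

Lemma omegaEA_id_normal (E : omegaEA_obj) :
  @omega_normal (ea_bpos E) (ea_bpos E) (fun x => x).
Proof. by []. Qed.

Definition omegaEA_id (E : omegaEA_obj) : omegaEA_hom E E :=
  @OmegaEAHom E E (fun x => x) erefl (fun a b c h => h)
    (@omegaEA_id_normal E).

Section OmegaEAComp.
Context (E F G : omegaEA_obj) (g : omegaEA_hom F G) (f : omegaEA_hom E F).

Lemma omegaEA_comp_one : g (f ea1) = ea1.
Proof. by rewrite !oea_one. Qed.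

Lemma omegaEA_comp_normal :
  @omega_normal (ea_bpos E) (ea_bpos G) (fun x => g (f x)).
Proof.
move=> x s xi xs.
apply: (@oea_normal _ _ g (f \o x) (f s)); last exact: oea_normal.
by move=> m n mn; apply: omegaEA_hom_homo; exact: xi.
Qed.

Definition omegaEA_comp : omegaEA_hom E G :=
  @OmegaEAHom E G (fun x => g (f x)) omegaEA_comp_one
    (fun a b c h => oea_oplus g (oea_oplus f h)) omegaEA_comp_normal.

End OmegaEAComp.

Lemma omegaEA_comp_idl E F (f : omegaEA_hom E F) :
  omegaEA_comp (omegaEA_id F) f = f.
Proof. exact: omegaEA_hom_eq. Qed.

Lemma omegaEA_comp_idr E F (f : omegaEA_hom E F) :
  omegaEA_comp f (omegaEA_id E) = f.
Proof. exact: omegaEA_hom_eq. Qed.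

Lemma omegaEA_compA E F G H (h : omegaEA_hom G H) (g : omegaEA_hom F G)
    (f : omegaEA_hom E F) :
  omegaEA_comp h (omegaEA_comp g f) = omegaEA_comp (omegaEA_comp h g) f.
Proof. exact: omegaEA_hom_eq. Qed.

Definition omegaEA : category :=
  Category omegaEA_comp_idl omegaEA_comp_idr omegaEA_compA.

Definition forget_hom (E F : omegaEA_obj) (f : omegaEA_hom E F) :
    bpos_hom (ea_bpos E) (ea_bpos F) :=
  @BPosHom (ea_bpos E) (ea_bpos F) f (fun x y => @omegaEA_hom_homo E F f x y)
    (omegaEA_hom0 f) (oea_one f).

Lemma forget_id (E : omegaEA_obj) :
  forget_hom (omegaEA_id E) = bpos_id (ea_bpos E).
Proof. exact: bpos_hom_eq. Qed.

Lemma forget_comp (E F G : omegaEA_obj) (g : omegaEA_hom F G)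
    (f : omegaEA_hom E F) :
  forget_hom (omegaEA_comp g f) = bpos_comp (forget_hom g) (forget_hom f).
Proof. exact: bpos_hom_eq. Qed.

Definition forgetful : functor omegaEA BPos :=
  @Functor omegaEA BPos (fun E : omegaEA_obj => ea_bpos E) forget_hom
    forget_id forget_comp.

(* The omega-Kalmbach extension is determined, up to isomorphism, as a left
   adjoint of [forgetful]. *)
Definition omega_kalmbach_monad (K : functor BPos omegaEA)
    (adj : adjunction K forgetful) : monad BPos := adjunction_monad adj.

(* Main.v *)
From mathcomp Require Import all_boot all_order.
From mathcomp Require Import boolp classical_sets.
Require Import Defs.

Set Implicit Arguments.
Unset Strict Implicit.
Unset Printing Implicit Defensive.

(** The equivalence is an instance of Beck's monadicity argument, applied to
    the forgetful functor [U] and an arbitrary left adjoint of it.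

    The reason the argument works is that everything in an omega-complete
    effect algebra is visible on chains.  The sum is recovered from
    differences: [a (+) b = c] says that [a <= c] and that [b] is the
    difference [c - a], an operation on two-element chains; completeness and
    normality are about increasing sequences.  Order-preserving maps carry
    chains to chains.  So if [h : U E -> A] is a retraction of bounded posets
    with monotone section [s], any chain of [A] can be moved by [s] into [E],
    the operation performed there, and the result brought back by [h].

    For an Eilenberg-Moore algebra [h : T A -> A] the unit is such a section,
    and the split fork of [T h] and the multiplication over [h] shows that the
    difference [h (s c - s a)] does not depend on representatives: it agrees
    with [h (z - x)] whenever [x <= z] lie above [a <= c]
    ([quot_sum_section]).  Hence [A] inherits an omega-complete effect algebra
    structure, with unchanged order, for which [h] is a morphism
    ([forgetful_realizes_split_forks]).  In the same way, a monotone map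
    that becomes a morphism after composition with a morphism that has a
    monotone section is itself a morphism ([forgetful_lifts_along_split_epis]).

    These two properties and the faithfulness of [U] make the comparison
    functor fully faithful and essentially surjective
    ([comparison_equivalence]). *)

Import Order.LTheory.

Local Open Scope classical_set_scope.
Local Open Scope cat_scope.

(** * Fully faithful, essentially surjective functors *)

Definition faithful (C D : category) (F : functor C D) : Prop :=
  forall (a b : C) (f g : hom a b), fmap F f = fmap F g -> f = g.

Definition full (C D : category) (F : functor C D) : Prop :=
  forall (a b : C) (g : hom (F a) (F b)), exists f : hom a b, fmap F f = g.

Definition essentially_surjective (C D : category) (F : functor C D) : Prop :=
  forall d : D, exists (c : C) (i : hom (F c) d), is_iso i.

Section EquivalenceFromFullyFaithful.
Context (C D : category) (F : functor C D).
Hypotheses (Ffaith : faithful F) (Ffull : full F).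

Lemma fully_faithful_reflects_iso (a b : C) (f : hom a b) :
  is_iso (fmap F f) -> is_iso f.
Proof.
case=> g [gf fg]; have [g' g'E] := Ffull g; exists g'.
by split; apply: Ffaith; rewrite fmap_comp fmap_id g'E.
Qed.

Hypothesis Fsurj : essentially_surjective F.

Let pre d : C := projT1 (cid (Fsurj d)).
Let iso d : hom (F (pre d)) d := projT1 (cid (projT2 (cid (Fsurj d)))).
Let iso_is_iso d : is_iso (iso d) := projT2 (cid (projT2 (cid (Fsurj d)))).
Let inv d : hom d (F (pre d)) := projT1 (cid (iso_is_iso d)).

Let isoK d : inv d \oc iso d = idm _.
Proof. by have [] := projT2 (cid (iso_is_iso d)). Qed.

Let invK d : iso d \oc inv d = idm _.
Proof. by have [] := projT2 (cid (iso_is_iso d)). Qed.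

Let lift (a b : C) (g : hom (F a) (F b)) : hom a b := projT1 (cid (Ffull g)).

Let liftE (a b : C) (g : hom (F a) (F b)) : fmap F (lift g) = g.
Proof. exact: projT2 (cid (Ffull g)). Qed.

Let qmap (d e : D) (g : hom d e) : hom (pre d) (pre e) :=
  lift (inv e \oc g \oc iso d).

Let qmap_id d : qmap (idm d) = idm (pre d).
Proof. by apply: Ffaith; rewrite liftE ccomp_idr isoK fmap_id. Qed.

Let qmap_comp (d e k : D) (g : hom e k) (f : hom d e) :
  qmap (g \oc f) = qmap g \oc qmap f.
Proof.
apply: Ffaith; rewrite fmap_comp !liftE !ccompA.
by rewrite -(ccompA (inv k \oc g) (iso e)) invK ccomp_idr.
Qed.

Let quasi_inverse : functor D C := Functor qmap_id qmap_comp.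

Let unit_natural (a b : C) (f : hom a b) :
  lift (iso (F b)) \oc fmap (functor_comp quasi_inverse F) f
  = f \oc lift (iso (F a)).
Proof.
rewrite -[fmap (functor_comp _ _) f]/(qmap (fmap F f)).
by apply: Ffaith; rewrite !fmap_comp !liftE !ccompA invK ccomp_idl.
Qed.

Let counit_natural (d e : D) (g : hom d e) :
  iso e \oc fmap (functor_comp F quasi_inverse) g = g \oc iso d.
Proof.
rewrite -[fmap (functor_comp _ _) g]/(fmap F (qmap g)).
by rewrite liftE !ccompA invK ccomp_idl.
Qed.

Lemma equivalence_of_fully_faithful : equivalent_categories C D.
Proof.
exists F, quasi_inverse; split.
  exists (@NatTrans _ _ (functor_comp quasi_inverse F) (functor_id C)
            (fun a => lift (iso (F a))) unit_natural) => a /=.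
  by apply: fully_faithful_reflects_iso; rewrite liftE.
by exists (@NatTrans _ _ (functor_comp F quasi_inverse) (functor_id D)
            iso counit_natural) => d /=.
Qed.

End EquivalenceFromFullyFaithful.

(** * A criterion for the comparison functor to be an equivalence *)

Section Comparison.
Context (C D : category) (F : functor C D) (G : functor D C).
Context (adj : adjunction F G).

Let T := adjunction_monad adj.
Let eta (a : C) : hom a (G (F a)) := adj_unit adj a.
Let eps (b : D) : hom (F (G b)) b := adj_counit adj b.

Let epsN (b e : D) (f : hom b e) : eps e \oc fmap F (fmap G f) = f \oc eps b.
Proof. exact: (naturality (adj_counit adj)). Qed.

Let etaN (a b : C) (f : hom a b) : eta b \oc f = fmap G (fmap F f) \oc eta a.
Proof. exact: (naturality (adj_unit adj)). Qed.

Let eps_eta (b : D) : fmap G (eps b) \oc eta (G b) = idm (G b).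
Proof. exact: adj_triangle_right. Qed.

(** A morphism out of a free object is determined by its transpose, because
    it can be rebuilt from it with the counit. *)
Lemma transpose_inj (a : C) (b : D) (f g : hom (F a) b) :
  fmap G f \oc adj_unit adj a = fmap G g \oc adj_unit adj a -> f = g.
Proof.
have transposeK k : k = eps b \oc fmap F (fmap G k \oc eta a).
  rewrite fmap_comp ccompA epsN -ccompA.
  by rewrite [X in _ \oc X]adj_triangle_left ccomp_idr.
by move=> fg; rewrite (transposeK f) (transposeK g) /eta fg.
Qed.

Lemma comparison_action_mult (b : D) :
  fmap G (eps b) \oc fmap T (fmap G (eps b))
  = fmap G (eps b) \oc monad_mult T (G b).
Proof. by rewrite /= -!fmap_comp epsN. Qed.

Definition comparison_obj (b : D) : em_algebra T :=
  @EMAlgebra C T (G b) (fmap G (eps b)) (eps_eta b) (comparison_action_mult b).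

Lemma comparison_map_action (b e : D) (f : hom b e) :
  fmap G f \oc em_action (comparison_obj b)
  = em_action (comparison_obj e) \oc fmap T (fmap G f).
Proof. by rewrite /= -!fmap_comp epsN. Qed.

Definition comparison_map (b e : D) (f : hom b e) :
    em_hom (comparison_obj b) (comparison_obj e) :=
  @EMHom C T (comparison_obj b) (comparison_obj e) (fmap G f)
    (comparison_map_action f).

Lemma comparison_map_id (b : D) :
  comparison_map (idm b) = em_id (comparison_obj b).
Proof. by apply: em_hom_eq; exact: fmap_id. Qed.

Lemma comparison_map_comp (b e k : D) (g : hom e k) (f : hom b e) :
  comparison_map (g \oc f) = em_comp (comparison_map g) (comparison_map f).
Proof. by apply: em_hom_eq; exact: fmap_comp. Qed.

Definition comparison : functor D (eilenberg_moore T) :=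
  @Functor D (eilenberg_moore T) comparison_obj comparison_map
    comparison_map_id comparison_map_comp.

(** An inverse on carriers automatically commutes with the actions, so
    isomorphisms of algebras can be recognised on carriers. *)
Lemma em_hom_is_iso (X Y : em_algebra T) (f : em_hom X Y) :
  is_iso (em_map f) -> @is_iso (eilenberg_moore T) X Y f.
Proof.
case=> g [gf fg].
have gP : g \oc em_action Y = em_action X \oc fmap T g.
  rewrite -[LHS]ccomp_idr -(fmap_id T) -fg fmap_comp ccompA.
  rewrite -(ccompA g) -em_map_action ccompA gf.
  by rewrite ccomp_idl.
by exists (EMHom gP); split; apply: em_hom_eq.
Qed.

(** The section [s] lives in [C], so that [p] can be a component of the counit,
    whose section is the unit; the condition then makes the comparison functor
    full. *)
Definition lifts_along_split_epis : Prop :=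
  forall (b e k : D) (p : hom b e) (q : hom b k)
    (s : hom (G e) (G b)) (u : hom (G e) (G k)),
  fmap G p \oc s = idm (G e) -> u \oc fmap G p = fmap G q ->
  exists v : hom e k, fmap G v = u.

(** A weak form of Beck's condition that [G] creates coequalizers of
    [G]-split pairs: the coequalizer [h] of a [G]-split pair, computed in [C],
    is up to isomorphism the image of a morphism of [D].  The universal
    property of that morphism in [D] is what the lifting condition above
    provides. *)
Definition realizes_split_forks : Prop :=
  forall (b e : D) (a : C) (p q : hom b e) (t : hom (G e) (G b))
    (h : hom (G e) a) (s : hom a (G e)),
  h \oc s = idm a -> fmap G p \oc t = idm (G e) ->
  fmap G q \oc t = s \oc h -> h \oc fmap G p = h \oc fmap G q ->
  exists (k : D) (i : hom (G k) a) (v : hom e k),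
    is_iso i /\ i \oc fmap G v = h.

(** Fullness lifts an algebra morphism along the counit, which the unit
    splits.  Surjectivity realizes the canonical presentation of an algebra
    [(X, h)], the split fork of the counit at [F X] and [F h].  The resulting
    isomorphism [i] is one of algebras since the counit at the new object
    has the same transpose as the composite of [v] with [F i]. *)
Theorem comparison_equivalence :
  faithful G -> lifts_along_split_epis -> realizes_split_forks ->
  equivalent_categories D (eilenberg_moore T).
Proof.
move=> Gfaith Glift Gfork;
  apply: (@equivalence_of_fully_faithful _ _ comparison).
- by move=> b e f g /(congr1 (@em_map _ _ _ _)); exact: Gfaith.
- move=> b e u.
  have [v vu] : exists v : hom b e, fmap G v = em_map u.
    apply: (Glift _ _ _ (eps b) (eps e \oc fmap F (em_map u)) (eta (G b))).
      exact: eps_eta.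
    by rewrite fmap_comp; exact: (em_map_action u).
  by exists v; exact: em_hom_eq.
- move=> X; set h : hom (G (F (em_carrier X))) (em_carrier X) := em_action X.
  have [k [i [v [ii iv]]]] :
    exists (k : D) (i : hom (G k) (em_carrier X))
      (v : hom (F (em_carrier X)) k), is_iso i /\ i \oc fmap G v = h.
    apply: (Gfork _ _ _ (eps (F (em_carrier X))) (fmap F h)
              (eta (G (F (em_carrier X)))) h (eta (em_carrier X))).
    + exact: em_action_unit.
    + exact: eps_eta.
    + by rewrite -etaN.
    + by rewrite [LHS](esym (em_action_mult X)).
  have epsE : eps k = v \oc fmap F i.
    apply: transpose_inj; rewrite -/(eta _) eps_eta fmap_comp -ccompA -etaN.
    have [j [ji ij]] := ii.
    have -> : fmap G v = j \oc h by rewrite -iv ccompA ji ccomp_idl.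
    by rewrite ccompA -(ccompA j) [h \oc _]em_action_unit ccomp_idr ji.
  have iP : i \oc em_action (comparison_obj k) = em_action X \oc fmap T i.
    by rewrite /= epsE fmap_comp ccompA iv.
  exists k, (@EMHom _ _ (comparison_obj k) X i iP).
  exact: em_hom_is_iso.
Qed.

End Comparison.

(** * Suprema of increasing sequences *)

Lemma supremums_rangeP (A : bposType) (x : nat -> A) (s : A) :
  supremums (range x) s <->
  (forall n, (x n <= s)%O) /\ (forall b, (forall n, (x n <= b)%O) -> (s <= b)%O).
Proof.
split=> -[ub lub]; split.
- by move=> n; apply: ub; exists n.
- by move=> b xb; apply: lub => _ [n _ <-].
- by move=> _ [n _ <-].
- by move=> b xb; apply: lub => n; apply: xb; exists n.
Qed.

Lemma supremums_range_uniq (A : bposType) (x : nat -> A) (s s' : A) :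
  supremums (range x) s -> supremums (range x) s' -> s = s'.
Proof.
move=> /supremums_rangeP[us ls] /supremums_rangeP[us' ls'].
by apply/le_anti/andP; split; [exact: ls | exact: ls'].
Qed.

Lemma eq_supremums_range (A : bposType) (x y : nat -> A) (s : A) :
  x =1 y -> supremums (range x) s -> supremums (range y) s.
Proof. by move=> /funext ->. Qed.

Lemma increasing_seq_comp (A B : bposType) (f : bpos_hom A B) (x : nat -> A) :
  increasing_seq x -> increasing_seq (f \o x).
Proof. by move=> xi m n mn; apply: bpos_homo; exact: xi. Qed.

(** An upper bound [b] of [x] gives the upper bound [s b] of [s \o x], so
    retracts inherit suprema, computed by applying the retraction. *)
Lemma supremums_retract (A B : bposType) (s : bpos_hom A B) (h : bpos_hom B A)
    (x : nat -> A) (m : B) :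
  cancel s h -> supremums (range (s \o x)) m -> supremums (range x) (h m).
Proof.
move=> hs /supremums_rangeP[ub lub]; apply/supremums_rangeP; split.
  by move=> n; rewrite -[x n]hs; apply: bpos_homo; exact: ub.
move=> b xb; rewrite -[b]hs; apply: bpos_homo; apply: lub => n.
by apply: bpos_homo; exact: xb.
Qed.

(** * Effect algebras and morphisms split by a monotone map *)

Section EffectAlgebraTheory.
Context (E : effectAlgebra).

(** If [a (+) b = c] then [b] is the orthosupplement of [c^perp (+) a], which
    does not mention [b]. *)
Lemma oplus_cancel (a b b' c : E) :
  oplus a b = Some c -> oplus a b' = Some c -> b = b'.
Proof.
have cc : oplus c (orth c) = Some (orth ea0) by apply/orthP.
suff orthE x : oplus a x = Some c ->
    exists2 e, oplus (orth c) a = Some e & x = orth e.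
  by move=> /orthE[e eE ->] /orthE[e']; rewrite eE => -[<-] ->.
rewrite oplusC => xa; have [e eE xe] := oplusA xa cc.
by exists e; [rewrite oplusC | apply/orthP; rewrite oplusC].
Qed.

Lemma oplus1_Some (y c : E) : oplus ea1 y = Some c -> y = ea0.
Proof. by move=> yc; apply: oplus1_eq0; rewrite oplusC yc. Qed.

End EffectAlgebraTheory.

(** Completeness of [E] supplies [n]; normality of [p] makes [p n] a supremum
    of [p \o s \o x = x], hence equal to [m]. *)
Lemma supremums_lift (E F : omegaEA_obj) (p : omegaEA_hom E F)
    (s : bpos_hom (ea_bpos F) (ea_bpos E)) (x : nat -> ea_bpos F)
    (m : ea_bpos F) :
  cancel s p -> increasing_seq x -> supremums (range x) m ->
  exists2 n : ea_bpos E, supremums (range (s \o x)) n & p n = m.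
Proof.
move=> ps xi xm; have sxi := increasing_seq_comp s xi.
have [n sn] := oea_complete sxi; exists n => //.
apply: supremums_range_uniq xm.
by apply: (eq_supremums_range _ (oea_normal p sxi sn)) => k /=; exact: ps.
Qed.

(** Sums and suprema in [F] can be formed in [E], on chains moved there by [s],
    and projected by [p]; as [u \o p = q] preserves them, so does [u]. *)
Section DescentAlongSplitEpi.
Context (E F K : omegaEA_obj) (p : omegaEA_hom E F) (q : omegaEA_hom E K).
Context (s : bpos_hom (ea_bpos F) (ea_bpos E)).
Context (u : bpos_hom (ea_bpos F) (ea_bpos K)).
Hypotheses (ps : cancel s p) (up : forall x, u (p x) = q x).

Lemma descent_oplus (a b c : F) :
  oplus a b = Some c -> oplus (u a) (u b) = Some (u c).
Proof.
move=> abc.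
(* [s] does not preserve sums, but [s a <= s c], and by cancellation the
   difference [y] lies above [b]. *)
have /(bpos_homo s) /ea_leP[y sy] : ((a : ea_bpos F) <= c)%O.
  by apply/ea_leP; exists b.
have bE : b = p y.
  by apply: (oplus_cancel abc); rewrite -{1}(ps a) -(ps c); exact: oea_oplus.
by rewrite bE -(ps a) -(ps c) !up; exact: oea_oplus.
Qed.

Lemma descent_normal : @omega_normal (ea_bpos F) (ea_bpos K) u.
Proof.
move=> x m xi /(supremums_lift ps xi)[n sn <-].
rewrite up; apply: (eq_supremums_range _ (oea_normal q _ sn)) => [k /=|].
  by rewrite -up ps.
exact: increasing_seq_comp.
Qed.

Definition descent : omegaEA_hom F K :=
  @OmegaEAHom F K u (bpos_top u) descent_oplus descent_normal.

End DescentAlongSplitEpi.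

(** * The effect algebra on a split quotient *)

Section PartialOperation.
Context (A : Type) (R : A -> A -> A -> Prop).
Hypothesis Rfun : forall a b c c', R a b c -> R a b c' -> c = c'.

Definition partial_op (a b : A) : option A :=
  if pselect (exists c, R a b c) is left e then Some (projT1 (cid e)) else None.

Lemma partial_opP a b c : partial_op a b = Some c <-> R a b c.
Proof.
rewrite /partial_op; case: pselect => [e|ne]; last first.
  by split=> // abc; case: ne; exists c.
have Re := projT2 (cid e); split=> [[<-] //|abc].
by congr Some; exact: Rfun Re abc.
Qed.

End PartialOperation.

(** For an Eilenberg-Moore algebra [(A, h)], the maps below are [p], the counit
    at the free object on [A], [q], the image of [h] under the free functor,
    and the units [t] and [s]. *)
Section SplitForkQuotient.
Context (E' E : omegaEA_obj) (A : bposType) (p q : omegaEA_hom E' E).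
Context (t : bpos_hom (ea_bpos E) (ea_bpos E')).
Context (h : bpos_hom (ea_bpos E) A) (s : bpos_hom A (ea_bpos E)).
Hypotheses (hs : cancel s h) (pt : cancel t p).
Hypotheses (qt : forall x, q (t x) = s (h x))
  (hpq : forall x, h (p x) = h (q x)).

(** The graph of the sum on [A] is the image under [h] of the graph of the sum
    of [E].  This form makes commutativity and the additivity of [h] immediate;
    that it is the graph of a partial function takes the split fork. *)
Definition quot_sum (a b c : A) : Prop :=
  exists x y z : E, [/\ oplus x y = Some z, h x = a, h y = b & h z = c].

Lemma quot_sumC a b c : quot_sum a b c -> quot_sum b a c.
Proof. by case=> x [y [z [xyz xa yb zc]]]; exists y, x, z; rewrite oplusC. Qed.

(** The representatives of [a] and [c] can be taken to be [s a] and [s c].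
    Given [x (+) y = z], move the chain [x <= z] along [t] and let [w] be the
    difference of its ends.  Then [q w] completes [s (h x)] to [s (h z)], while
    [p w] completes [x] to [z] and so is [y]; finally [h] identifies [p w] and
    [q w]. *)
Lemma quot_sum_section a b c :
  quot_sum a b c <-> exists2 y : E, oplus (s a) y = Some (s c) & h y = b.
Proof.
split=> [[x [y [z [xyz <- <- <-]]]]|[y sy <-]]; last first.
  by exists (s a), y, (s c); rewrite !hs.
have /(bpos_homo t)/ea_leP[w tw] : ((x : ea_bpos E) <= z)%O.
  by apply/ea_leP; exists y.
exists (q w); first by rewrite -!qt; exact: oea_oplus.
rewrite -hpq; congr (h _); apply: (oplus_cancel (a := x) (c := z)) xyz.
by rewrite -{1}(pt x) -(pt z); exact: oea_oplus.
Qed.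

Lemma quot_sum_cancel a b b' c :
  quot_sum a b c -> quot_sum a b' c -> b = b'.
Proof.
move=> /quot_sum_section[y sy <-] /quot_sum_section[y' sy' <-].
by rewrite (oplus_cancel sy sy').
Qed.

Lemma le_quot_sum a c : (a <= c)%O <-> exists b, quot_sum a b c.
Proof.
split=> [/(bpos_homo s)/ea_leP[y sy]|[b /quot_sum_section[y sy _]]].
  by exists (h y); apply/quot_sum_section; exists y.
by rewrite -(hs a) -(hs c); apply: bpos_homo; apply/ea_leP; exists y.
Qed.

(** The chain [a <= ab <= abc] is moved by [s] to a chain of [E] whose
    successive differences lie above [b] and [c]. *)
Lemma quot_sumA a b c ab abc :
  quot_sum a b ab -> quot_sum ab c abc ->
  exists2 bc, quot_sum b c bc & quot_sum a bc abc.
Proof.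
move=> /quot_sum_section[y sy yb] /quot_sum_section[z sz zc].
have [yz yzE syz] := oplusA sy sz; exists (h yz); first by exists y, z, yz.
by apply/quot_sum_section; exists yz.
Qed.

Definition quot_orth (a : A) : A := h (orth (s a)).

Lemma quot_orthP a b : quot_sum a b \top%O <-> b = quot_orth a.
Proof.
have ao : quot_sum a (quot_orth a) \top%O.
  apply/quot_sum_section; exists (orth (s a)) => //.
  by rewrite bpos_top; apply/orthP.
by split=> [ab|-> //]; exact: quot_sum_cancel ab ao.
Qed.

Lemma quot_orth0 : quot_orth \bot%O = \top%O.
Proof. by rewrite /quot_orth bpos_bot; exact: (bpos_top h). Qed.

(** Cancellation gives uniqueness of a summand; to turn it into uniqueness of
    the sum, rewrite [a (+) b = c] as [a (+) c^perp = b^perp]. *)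
Lemma quot_sum_fun a b c c' : quot_sum a b c -> quot_sum a b c' -> c = c'.
Proof.
have orthK d : d = quot_orth (quot_orth d).
  by apply/quot_orthP/quot_sumC/quot_orthP.
have orth_sum d : quot_sum a b d -> quot_sum a (quot_orth d) (quot_orth b).
  move=> /quot_sumC bad; have /quot_orthP dd := erefl (quot_orth d).
  by have [e ae /quot_orthP <-] := quot_sumA bad dd.
move=> /orth_sum abc /orth_sum abc'.
by rewrite (orthK c) (quot_sum_cancel abc abc') -orthK.
Qed.

Let sumP := partial_opP quot_sum_fun.
Let sum := partial_op quot_sum.

Let sum_sumC a b : sum a b = sum b a.
Proof.
have le_sum x y c : sum x y = Some c -> sum y x = Some c.
  by move=> /sumP/quot_sumC/sumP.
case ab: (sum a b) => [c|]; first by rewrite (le_sum _ _ _ ab).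
by case ba: (sum b a) => [c|] //; rewrite (le_sum _ _ _ ba) in ab.
Qed.

Let sum0 a : sum a \bot%O = Some a.
Proof.
apply/sumP/quot_sum_section; exists ea0; first exact: oplus0.
exact: (bpos_bot h).
Qed.

Let sumA a b c ab abc :
  sum a b = Some ab -> sum ab c = Some abc ->
  exists2 bc, sum b c = Some bc & sum a bc = Some abc.
Proof.
move=> /sumP aab /sumP abc'; have [bc bcE abcE] := quot_sumA aab abc'.
by exists bc; apply/sumP.
Qed.

Let sum_orthP a b : sum a b = Some (quot_orth \bot%O) <-> b = quot_orth a.
Proof. by rewrite quot_orth0 sumP; exact: quot_orthP. Qed.

Let sum1_eq0 a : isSome (sum a (quot_orth \bot%O)) -> a = \bot%O.
Proof.
rewrite quot_orth0; case ac: (sum a _) => [c|] // _.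
move: ac => /sumP/quot_sumC/quot_sum_section[y].
by rewrite bpos_top => /oplus1_Some -> <-; exact: (bpos_bot h).
Qed.

Definition quot_ea : effectAlgebra :=
  EffectAlgebra sum_sumC sum0 sumA sum_orthP sum1_eq0.

(** The order defined by the sum is the original one, so that [quot_ea] really
    lives on the bounded poset [A]; the two mutually inverse maps below are the
    identity on elements. *)
Lemma quot_ea_leE (a b : quot_ea) :
  ((a : ea_bpos quot_ea) <= b)%O <-> ((a : A) <= (b : A))%O.
Proof.
rewrite ea_leP le_quot_sum.
by split=> -[c abc]; exists c; apply/sumP.
Qed.

Definition of_quot : bpos_hom (ea_bpos quot_ea) A :=
  @BPosHom (ea_bpos quot_ea) A (fun a => a)
    (fun a b => (quot_ea_leE a b).1) erefl quot_orth0.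

Definition to_quot : bpos_hom A (ea_bpos quot_ea) :=
  @BPosHom A (ea_bpos quot_ea) (fun a => a)
    (fun a b => (quot_ea_leE a b).2) erefl (esym quot_orth0).

Lemma quot_complete : omega_complete (ea_bpos quot_ea).
Proof.
move=> x /(increasing_seq_comp (bpos_comp s of_quot))/oea_complete[m sm].
exists (to_quot (h m)).
by apply: (supremums_retract (s := bpos_comp s of_quot)
             (h := bpos_comp to_quot h)) sm => a /=; exact: hs.
Qed.

Definition quot_oea : omegaEA_obj := OmegaEAObj quot_complete.

Lemma quot_proj_oplus (x y z : E) :
  oplus x y = Some z ->
  @oplus quot_ea (h x) (h y) = Some (h z : quot_ea).
Proof. by move=> xyz; apply/sumP; exists x, y, z. Qed.

(** Only sequences moved from [A] by [s] have their supremum preserved by [h]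
    for trivial reasons.  A sequence [x] of [E] with supremum [m] is replaced by
    [q \o t \o x = s \o h \o x]: writing [m = p n] with [n] the supremum of
    [t \o x], the supremum [q n] of that sequence has the same image under [h]
    as [m]. *)
Lemma quot_proj_normal : @omega_normal (ea_bpos E) (ea_bpos quot_oea) h.
Proof.
move=> x m xi xm.
move: (supremums_lift pt xi xm) => [n tn <-]; rewrite hpq.
apply: (supremums_retract (s := bpos_comp s of_quot)
          (h := bpos_comp to_quot h)); first by move=> a /=; exact: hs.
apply: (eq_supremums_range _ (oea_normal q _ tn)) => [k /=|].
  exact: qt.
exact: increasing_seq_comp.
Qed.

Definition quot_proj : omegaEA_hom E quot_oea :=
  @OmegaEAHom E quot_oea h (etrans (bpos_top h) (esym quot_orth0))
    quot_proj_oplus quot_proj_normal.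

End SplitForkQuotient.

(** * Monadicity of the forgetful functor *)

Lemma BPos_hom_ext (A B : BPos) (f g : hom A B) :
  f = g <-> (f : bpos_hom A B) =1 (g : bpos_hom A B).
Proof. by split=> [-> //|]; exact: bpos_hom_eq. Qed.

Lemma forgetful_faithful : faithful forgetful.
Proof.
by move=> E F f g /BPos_hom_ext fg; exact: omegaEA_hom_eq.
Qed.

Lemma forgetful_lifts_along_split_epis : lifts_along_split_epis forgetful.
Proof.
move=> E F K p q s u /BPos_hom_ext ps /BPos_hom_ext up.
by exists (descent (ps : cancel s p) up); apply/BPos_hom_ext.
Qed.

Lemma forgetful_realizes_split_forks : realizes_split_forks forgetful.
Proof.
move=> E' E A p q t h s /BPos_hom_ext hs /BPos_hom_ext pt.
move=> /BPos_hom_ext qt /BPos_hom_ext hpq.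
have {}hs : cancel (s : bpos_hom _ _) (h : bpos_hom _ _) := hs.
have {}pt : cancel (t : bpos_hom _ _) p := pt.
exists (quot_oea hs pt qt hpq), (of_quot hs pt qt hpq).
exists (quot_proj hs pt qt hpq); split; last exact/BPos_hom_ext.
by exists (to_quot hs pt qt hpq); split; exact/BPos_hom_ext.
Qed.

Theorem theorem34 (K_omega : functor BPos omegaEA)
    (adj : adjunction K_omega forgetful) :
  equivalent_categories omegaEA
    (eilenberg_moore (omega_kalmbach_monad adj)).
Proof.
exact: comparison_equivalence forgetful_faithful
  forgetful_lifts_along_split_epis forgetful_realizes_split_forks.
Qed.
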